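(* Suppose that the linear bounded operator $P\in L(X_h;X)$ and the constant $\Lambda_P\ge0$ satisfy $$\|x_h-Px_h\|_{\widehat X}\le\Lambda_P\|x_h-x\|_{\widehat X}\qquad\text{for all }x_h\in X_h\text{ and all }x\in X.$$ Then the following two statements are equivalent. (QO) There exists $C_{qo}>0$ such that $\|x-Mx\|_{\widehat X}\le C_{qo}\min_{x_h\in X_h}\|x-x_h\|_{\widehat X}$ for all $x\in X$. (H) There exists $\Lambda_H>0$ such that $a_h(x_h,y_h)-a(Px_h,Qy_h)\le\Lambda_H\|x_h-Px_h\|_{\widehat X}\|y_h\|_{Y_h}$ for all $x_h\in X_h$ and $y_h\in Y_h$.
   Context: Setting: $\widehat X$ and $\widehat Y$ are real Hilbert spaces with $\widehat X=X+X_h$ and $\widehat Y=Y+Y_h$ (sums not necessarily direct), where $X,X_h\subset\widehat X$ and $Y,Y_h\subset\widehat Y$ are complete subspaces (with the inherited norms) and $\dim X_h=\dim Y_h<\infty$. $a:X\times Y\to\mathbb R$ and $a_h:X_h\times Y_h\to\mathbb R$ are bounded bilinear forms that satisfy inf-sup conditions with constants $\alpha>0$ and $\alpha_h>0$ and are non-degenerate, so that the associated operators $A\in L(X;Y^* )$, $Ax:=a(x,\cdot)$, and $A_h\in L(X_h;Y_h^* )$, $A_hx_h:=a_h(x_h,\cdot)$, are bijective. $Q\in L(Y_h;Y)$ is a linear bounded operator. $M:=A_h^{-1}Q^*A\in L(X;X_h)$; that is, for $x\in X$, $Mx\in X_h$ is the unique element with $a_h(Mx,y_h)=a(x,Qy_h)$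 for all $y_h\in Y_h$. *)

(* Defs.v *)
From HB Require Import structures.
From mathcomp Require Import all_boot all_order all_algebra.
From mathcomp Require Import all_classical all_reals all_analysis.
From mathcomp Require Import ring lra.
Set Implicit Arguments.
Unset Strict Implicit.
Unset Printing Implicit Defensive.
Import Order.TTheory GRing.Theory Num.Theory.
Import numFieldNormedType.Exports.
Local Open Scope classical_set_scope.
Local Open Scope ring_scope.

(* [normedModType] fixes the norm first; the inner product has to induce it. *)
HB.mixin Record NormedModule_isHilbert (R : realType) V
    of CompleteNormedModule R V := {
  inner : V -> V -> R ;
  innerC : forall u v, inner u v = inner v u ;
  inner_linear : forall u, linear_for *%R (inner u) ;
  inner_norm : forall u, inner u u = `|u| ^+ 2
}.

#[short(type="hilbertType")]
HB.structure Definition Hilbert (R : realType) :=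
  {V of CompleteNormedModule R V & NormedModule_isHilbert R V}.

(* The elements of [U] are those of the linear subspace [S] of [V], and
   [val : U -> V] is the inclusion.  [U] is complete for the norm of [V]. *)
HB.mixin Record isSubNormed (R : numFieldType) (V : normedModType R)
    (S : pred V) U of @GRing.SubLmodule R V S U & CompleteNormedModule R U := {
  norm_val : forall u : U, `|u| = `|\val u|
}.

#[short(type="completeSubspaceType")]
HB.structure Definition CompleteSubspace (R : numFieldType)
    (V : normedModType R) (S : pred V) :=
  {U of @GRing.SubLmodule R V S U & CompleteNormedModule R U
      & isSubNormed R V S U}.

Section Operators.
Variables (R : realType).

Definition bounded_op (U V : normedModType R) (f : U -> V) :=
  exists C : R, forall u, `|f u| <= C * `|u|.

Definition bounded_form (U V : normedModType R) (b : U -> V -> R) :=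
  exists C : R, forall u v, `|b u v| <= C * `|u| * `|v|.

(* inf_{u <> 0} sup_{v <> 0} b(u, v) / (|u| |v|) >= c, in [\bar R] so that
   zero spaces and unbounded quotients need no convention. *)
Definition inf_sup (U V : normedModType R) (b : U -> V -> R) (c : R) :=
  (c%:E <= ereal_inf [set ereal_sup
             [set (b u v / (`|u| * `|v|))%:E | v in [set v : V | v != 0%R]]
           | u in [set u : U | u != 0%R]])%E.

Definition nondegenerate_form (U V : normedModType R) (b : U -> V -> R) :=
  forall v, v != 0 -> exists u, b u v != 0.

(* u |-> b(u, .); the dual space is not a separate type, its elements are
   viewed as plain functions. *)
Definition form_op (U V : normedModType R) (b : U -> V -> R) : U -> (V -> R) :=
  fun u v => b u v.

Definition adjoint_op (U V : normedModType R) (f : U -> V) :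
    (V -> R) -> (U -> R) :=
  fun phi => phi \o f.

(* Ah^-1 Q^* A; ['pinv_] is a genuine inverse on the range of Ah, which is the
   whole dual of Yh when Ah is bijective (see [galerkinP]). *)
Definition galerkin (X Y Xh Yh : normedModType R)
    (a : X -> Y -> R) (ah : Xh -> Yh -> R) (Q : Yh -> Y) : X -> Xh :=
  'pinv_(fun=> 0) setT (form_op ah) \o adjoint_op Q \o form_op a.

(* The infimum is a minimum, see [best_errorP]. *)
Definition best_error (V : normedModType R) (S : pred V)
    (U : completeSubspaceType S) (v : V) : R :=
  inf (range (fun u : U => `|v - val u|)).

End Operators.

Lemma parallelogram (R : realType) (V : hilbertType R) (x y : V) :
  `|x + y| ^+ 2 + `|x - y| ^+ 2 = 2 * `|x| ^+ 2 + 2 * `|y| ^+ 2.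
Proof.
have D u v w : inner u (v + w) = inner u v + inner u w.
  by have := inner_linear u 1 v w; rewrite scale1r mul1r.
have N u v : inner u (- v) = - inner u v.
  have := inner_linear u (-1) v 0.
  rewrite scaleN1r addr0 mulN1r => ->.
  have := inner_linear u (-1) 0 0.
  by rewrite scaler0 addr0 mulN1r addNr => ->; rewrite addr0.
rewrite -!inner_norm !(D, N) (innerC (x + y)) (innerC (x - y)).
rewrite (innerC (x + y) y) (innerC (x - y) y) !(D, N) (innerC y x).
by ring.
Qed.

Lemma best_errorP (R : realType) (V : hilbertType R) (S : {pred V})
    (U : completeSubspaceType S) (v : V) :
  (exists u : U, best_error U v = `|v - val u|) /\
  forall u : U, best_error U v <= `|v - val u|.
Proof.
set d := best_error U v; set D := range (fun u : U => `|v - val u|).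
have Dlb : has_lbound D by exists 0 => _ [u _ <-].
have D0 : D !=set0 by exists `|v - val (0 : U)|; exists 0.
have dle (u : U) : d <= `|v - val u| by apply: ge_inf => //; exists u.
split=> //.
have d0 : 0 <= d by apply: lb_le_inf => // _ [u _ <-].
have /choice[z zP] n : exists u : U, `|v - val u| < d + n.+1%:R^-1.
  have [|_ [u _ <-] ?] := @inf_adherent _ D n.+1%:R^-1 _ (conj D0 Dlb).
    by rewrite invr_gt0.
  by exists u.
have zC (n m : nat) : (n <= m)%N ->
    `|z n - z m| ^+ 2 <= (8 * d + 4) * n.+1%:R^-1.
  move=> nm; rewrite norm_val raddfB /=.
  have := parallelogram (v - val (z n)) (v - val (z m)).
  have := dle (2^-1 *: (z n + z m)); rewrite linearZ raddfD /=.
  have -> : v - val (z n) + (v - val (z m)) =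
            2 *: (v - 2^-1 *: (val (z n) + val (z m))).
    rewrite scalerBr scalerA divff ?pnatr_eq0// scale1r scaler_nat mulr2n.
    by rewrite opprD addrACA.
  have -> : v - val (z n) - (v - val (z m)) = val (z m) - val (z n).
    by rewrite opprB addrC addrA subrK.
  rewrite (distrC (val (z m))) normrZ (ger0_norm (ler0n R 2)).
  have := zP n; have := zP m.
  have : (m.+1%:R^-1 : R) <= n.+1%:R^-1 by rewrite lef_pV2 ?posrE// ler_nat.
  have : (n.+1%:R^-1 : R) <= 1 by rewrite invf_le1// ler1n.
  have : 0 < (m.+1%:R^-1 : R) by rewrite invr_gt0.
  have := normr_ge0 (v - val (z n)); have := normr_ge0 (v - val (z m)).
  set p := `|v - val (z n)|; set q := `|v - val (z m)|; set w := `|v - _|.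
  set s := n.+1%:R^-1; set t := m.+1%:R^-1 => q0 p0 t0 s1 ts qlt plt dw.
  have p2 : p ^+ 2 <= (d + s) ^+ 2 by rewrite ler_sqr ?nnegrE; lra.
  have q2 : q ^+ 2 <= (d + s) ^+ 2 by rewrite ler_sqr ?nnegrE; lra.
  have w2 : d ^+ 2 <= w ^+ 2 by rewrite ler_sqr ?nnegrE; lra.
  have s2 : s * s <= s by rewrite ler_piMl; lra.
  by lra.
have : cvg (z @ \oo).
  apply: cauchy_cvg; apply: cauchy_exP => e e0.
  have c0 : 0 < e ^+ 2 / (8 * d + 4) by rewrite divr_gt0 ?exprn_gt0//; lra.
  have [N _ NP] := near_infty_natSinv_lt (PosNum c0).
  exists (z N); exists N => // m /= Nm.
  rewrite -ball_normE /= -ltr_sqr ?nnegrE ?(ltW e0)//.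
  apply: le_lt_trans (zC _ _ Nm) _.
  have k0 : 0 < 8 * d + 4 by lra.
  by rewrite mulrC -ltr_pdivlMr//; exact: (NP N (leqnn N)).
move=> /cvg_ex[u zu]; exists u; apply/eqP; rewrite eq_le dle /=.
suff H (e : R) : 0 < e -> `|v - val u| <= d + e by apply/ler_addgt0Pr.
move=> e0.
have e2 : 0 < e / 2 by lra.
have [N1 _ N1P] := near_infty_natSinv_lt (PosNum e2).
have /cvgrPdist_lt /(_ _ e2)[N2 _ N2P] := zu.
set m := maxn N1 N2.
have h2 : m.+1%:R^-1 < e / 2 := N1P m (leq_maxl _ _).
have : `|u - z m| < e / 2 := N2P m (leq_maxr _ _).
rewrite norm_val raddfB /= => h1; have h3 := zP m.
have := ler_normD (v - val (z m)) (val (z m) - val u).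
rewrite addrA subrK (distrC (val (z m)) (val u)) => h4.
apply: (le_trans h4); rewrite [e]splitr addrA.
by apply: lerD; [apply: (le_trans (ltW h3)); rewrite lerD2l|]; exact: ltW.
Qed.

Lemma galerkinP (R : realType) (X Y Xh Yh : normedModType R) (n : nat)
    (dimXh : Vector.axiom n Xh) (dimYh : Vector.axiom n Yh)
    (a : {bilinear X -> Y -> R | *%R & *%R})
    (ah : {bilinear Xh -> Yh -> R | *%R & *%R}) (c : R) (Q : {linear Yh -> Y}) :
  0 < c -> inf_sup ah c ->
  forall x yh, ah (galerkin a ah Q x) yh = a x (Q yh).
Proof.
move=> c0 ish.
have inj (u : Xh) : (forall y, ah u y = 0) -> u = 0.
  move=> u0; apply/eqP/negPn/negP => un0; move: ish; rewrite /inf_sup.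
  apply/negP; rewrite -ltNge.
  apply: (@le_lt_trans _ _ 0%E); last by rewrite lte_fin.
  apply: ge_ereal_inf; eexists; first by exists u.
  by apply: ge_ereal_sup => _ [y _ <-]; rewrite u0 mul0r.
have [eX eXl [gX eXK gXK]] := dimXh; have [eY eYl [gY eYK gYK]] := dimYh.
pose G := \matrix_(i < n, j < n) ah (gX (delta_mx 0 i)) (gY (delta_mx 0 j)).
have gXl : linear gX.
  move=> k r s; apply: (can_inj eXK); rewrite gXK.
  by rewrite eXl !gXK.
have gYl : linear gY.
  move=> k r s; apply: (can_inj eYK); rewrite gYK.
  by rewrite eYl !gYK.
pose GX : {linear 'rV[R]_n -> Xh} :=
  HB.pack gX (GRing.isLinear.Build _ _ _ _ gX gXl).
pose GY : {linear 'rV[R]_n -> Yh} :=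
  HB.pack gY (GRing.isLinear.Build _ _ _ _ gY gYl).
have GXS r : gX r = \sum_i r 0 i *: gX (delta_mx 0 i).
  rewrite {1}(row_sum_delta r) [LHS](raddf_sum GX).
  by apply: eq_bigr => i _; exact: (linearZ_LR GX).
have GYS r : gY r = \sum_i r 0 i *: gY (delta_mx 0 i).
  rewrite {1}(row_sum_delta r) [LHS](raddf_sum GY).
  by apply: eq_bigr => i _; exact: (linearZ_LR GY).
have ahE (r s : 'rV[R]_n) : ah (gX r) (gY s) = (r *m G *m s^T) 0 0.
  rewrite (GYS s) linear_sumr mxE; apply: eq_bigr => j _.
  rewrite linearZr_LR /= !mxE mulrC; congr (_ * _).
  rewrite (GXS r) linear_sumlz; apply: eq_bigr => i _.
  by rewrite linearZl_LR /= !mxE.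
have Gf : row_free G.
  apply: inj_row_free => v vG; apply: (can_inj gXK).
  rewrite [gX 0](raddf0 GX); apply: inj => y.
  by rewrite -(eYK y) ahE vG mul0mx mxE.
have Gu : G \in unitmx by rewrite -row_free_unit.
move=> x yh; rewrite /galerkin /=.
set phi := adjoint_op _ _.
suff : phi \in form_op ah @` setT.
  move=> /(@pinvK _ _ (fun=> 0) _ (form_op ah)) phiK.
  exact: (congr1 (@^~ yh) phiK).
pose b : 'rV[R]_n := \row_j a x (Q (gY (delta_mx 0 j))).
apply/mem_set; exists (gX (b *m invmx G)) => //; apply/funext => y.
rewrite /form_op /phi /adjoint_op /= -(eYK y) ahE mulmxKV// mxE.
rewrite [in RHS]GYS (linear_sum Q) /= /form_op linear_sumr.
apply: eq_bigr => j _.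
by rewrite !mxE linearZ /= linearZr_LR mulrC.
Qed.

(* Main.v *)
Require Import Defs.
From mathcomp Require Import all_boot all_order all_algebra.
From mathcomp Require Import all_classical all_reals all_analysis.
Import Order.TTheory GRing.Theory Num.Theory.
Import numFieldNormedType.Exports.
Local Open Scope classical_set_scope.
Local Open Scope ring_scope.

Set Implicit Arguments.
Unset Strict Implicit.
Unset Printing Implicit Defensive.

(** Everything rests on the identity [ah (M x) yh = a x (Q yh)] ([galerkinP]),
which turns the defect in (H) into a discrete residual,
[ah xh yh - a (P xh) (Q yh) = ah (xh - M (P xh)) yh].

Quasi-optimality implies (H) because [xh] itself is a competitor for the best
approximation of [P xh]: then [P xh - M (P xh)], and with it [xh - M (P xh)], is
controlled by [xh - P xh], and boundedness of [ah] finishes.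

Conversely, let [xh] be the best approximation of [x].  By the discrete inf-sup
condition ([inf_sup_norm_le]) it suffices to bound the residual
[ah (xh - M x) yh = (ah xh yh - a (P xh) (Q yh)) + a (P xh - x) (Q yh)].
The first summand is (H), the second boundedness of [a] and [Q]; both lead to
distances that the quasi-optimality of [P] reduces to [xh - x]. *)

Lemma bounded_op_ge0 (R : realType) (U V : normedModType R) (f : U -> V) :
  bounded_op f -> exists2 C : R, 0 <= C & forall u, `|f u| <= C * `|u|.
Proof.
move=> [C fC]; exists `|C| => // u.
by apply: (le_trans (fC u)); rewrite ler_wpM2r// ler_norm.
Qed.

Lemma bounded_form_ge0 (R : realType) (U V : normedModType R)
    (b : U -> V -> R) :
  bounded_form b ->
  exists2 C : R, 0 <= C & forall u v, `|b u v| <= C * `|u| * `|v|.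
Proof.
move=> [C bC]; exists `|C| => // u v.
by apply: (le_trans (bC u v)); rewrite -!mulrA ler_wpM2r ?mulr_ge0// ler_norm.
Qed.

(** The form in which the inf-sup condition is used: a bound on the functional
[b u] bounds [u]. *)
Lemma inf_sup_norm_le (R : realType) (U V : normedModType R)
    (b : U -> V -> R) (c K : R) (u : U) :
  inf_sup b c -> 0 <= K -> (forall v, b u v <= K * `|v|) -> c * `|u| <= K.
Proof.
move=> bc K0 bK; have [->|u0] := eqVneq u 0; first by rewrite normr0 mulr0.
have nu : 0 < `|u| by rewrite normr_gt0.
rewrite -ler_pdivlMr// -lee_fin; apply: (le_trans bc).
apply: ge_ereal_inf; eexists; first by exists u.
apply: ge_ereal_sup => _ [v v0 <-].
have nv : 0 < `|v| by rewrite normr_gt0.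
by rewrite lee_fin ler_pdivrMr ?mulr_gt0// mulrA divfK ?gt_eqF.
Qed.

Lemma norm_subspaceB (R : realType) (V : normedModType R) (S : {pred V})
    (U : completeSubspaceType S) (u v : U) : `|u - v| = `|val u - val v|.
Proof. by rewrite norm_val raddfB. Qed.

Theorem theorem2p3 (R : realType) (hX hY : hilbertType R)
    (SX SXh : {pred hX}) (SY SYh : {pred hY})
    (X : completeSubspaceType SX) (Xh : completeSubspaceType SXh)
    (Y : completeSubspaceType SY) (Yh : completeSubspaceType SYh)
    (sumX : forall u : hX, exists (x : X) (xh : Xh), u = val x + val xh)
    (sumY : forall v : hY, exists (y : Y) (yh : Yh), v = val y + val yh)
    (n : nat) (dimXh : Vector.axiom n Xh) (dimYh : Vector.axiom n Yh)
    (a : {bilinear X -> Y -> R | *%R & *%R})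
    (ah : {bilinear Xh -> Yh -> R | *%R & *%R})
    (a_bounded : bounded_form a) (ah_bounded : bounded_form ah)
    (alpha alphah : R) (alpha_gt0 : 0 < alpha) (alphah_gt0 : 0 < alphah)
    (a_infsup : inf_sup a alpha) (ah_infsup : inf_sup ah alphah)
    (a_nondeg : nondegenerate_form a) (ah_nondeg : nondegenerate_form ah)
    (Q : {linear Yh -> Y}) (Q_bounded : bounded_op Q)
    (P : {linear Xh -> X}) (P_bounded : bounded_op P)
    (LambdaP : R) (LambdaP_ge0 : 0 <= LambdaP)
    (P_quasi : forall (xh : Xh) (x : X),
       `|val xh - val (P xh)| <= LambdaP * `|val xh - val x|) :
  let M : X -> Xh := galerkin a ah Q in
  (exists2 Cqo : R, 0 < Cqo &
     forall x : X, `|val x - val (M x)| <= Cqo * best_error Xh (val x))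
  <->
  (exists2 LambdaH : R, 0 < LambdaH &
     forall (xh : Xh) (yh : Yh),
       ah xh yh - a (P xh) (Q yh)
         <= LambdaH * `|val xh - val (P xh)| * `|yh|).
Proof.
move=> M.
have ME x yh : ah (M x) yh = a x (Q yh).
  exact: (galerkinP dimXh dimYh a Q alphah_gt0 ah_infsup).
have [Ca Ca0 aC] := bounded_form_ge0 a_bounded.
have [Cah Cah0 ahC] := bounded_form_ge0 ah_bounded.
have [CQ CQ0 QC] := bounded_op_ge0 Q_bounded.
split=> [[Cqo Cqo0 qo]|[LH LH0 H]].
  (* The boundedness constant may vanish, whereas Lambda_H must be positive:
     hence the summand 1. *)
- exists ((Cah + 1) * (1 + Cqo)) => [|xh yh].
    by rewrite mulr_gt0 ?ltr_wpDl ?addr_gt0.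
  rewrite -ME -linearBl; apply: (le_trans (ler_norm _)).
  apply: (le_trans (ahC _ _)); rewrite ler_wpM2r// -mulrA.
  apply: ler_pM => //; first by rewrite lerDl.
  rewrite norm_subspaceB mulrDl mul1r.
  apply: (le_trans (ler_distD (val (P xh)) _ _)); rewrite lerD2l.
  apply: (le_trans (qo _)); rewrite ler_pM2l// distrC.
  exact: (best_errorP Xh (val (P xh))).2.
(* [K] bounds the residual of the best approximation: the first term comes from
   (H), the second from [P xh - x]. *)
pose K := LH * LambdaP + Ca * (1 + LambdaP) * CQ.
have K0 : 0 <= K by rewrite addr_ge0 ?mulr_ge0 ?addr_ge0// ltW.
exists (1 + K / alphah) => [|x].
  by rewrite ltr_wpDr// divr_ge0// ltW.
have [[xh xhE] _] := best_errorP Xh (val x).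
rewrite {}xhE (distrC _ (val xh)); set d := `|val xh - val x|.
have d0 : 0 <= d by exact: normr_ge0.
have xhP : `|val xh - val (P xh)| <= LambdaP * d := P_quasi xh x.
have Px : `|P xh - x| <= (1 + LambdaP) * d.
  rewrite norm_subspaceB mulrDl mul1r.
  apply: (le_trans (ler_distD (val xh) _ _)).
  by rewrite [leRHS]addrC lerD// distrC.
have xhM : alphah * `|xh - M x| <= K * d.
  apply: (inf_sup_norm_le ah_infsup); first by rewrite mulr_ge0.
  (* Insert [a (P xh) (Q yh)] to expose the defect in (H). *)
  move=> yh; rewrite linearBl /= ME.
  rewrite -[ah xh yh](subrK (a (P xh) (Q yh))) -addrA -linearBl.
  rewrite /K mulrDl mulrDl; apply: lerD.
    by apply: (le_trans (H _ _)); rewrite ler_wpM2r// -mulrA ler_pM2l//.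
  apply: (le_trans (ler_norm _)); apply: (le_trans (aC _ _)).
  have -> : Ca * (1 + LambdaP) * CQ * d * `|yh| =
            (Ca * ((1 + LambdaP) * d)) * (CQ * `|yh|).
    by rewrite !mulrA (mulrAC _ CQ d).
  by apply: ler_pM; rewrite ?mulr_ge0// ler_wpM2l.
rewrite mulrDl mul1r; apply: (le_trans (ler_distD (val xh) _ _)).
rewrite (distrC (val x)) -/d lerD2l -norm_subspaceB mulrAC ler_pdivlMr//.
by rewrite mulrC.
Qed.
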